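(* Let $n\ge 1$, let $a_1,\dots,a_n>0$ with the convention $a_0=a_{n+1}=0$, and let $\gamma_0,\dots,\gamma_n$ satisfy $\gamma_1,\dots,\gamma_{n-1}>0$ and $\gamma_0=\gamma_n=1$. Assume that $$a_k^2\,\gamma_k\gamma_{k-1}\ \ge\ a_{k-1}a_{k+1}\qquad\text{for all }1\le k\le n.$$ Let $V:\{0,\dots,n\}\to\mathbb{R}$, let $H=-A+V$, and let $(\psi_k)_{k=0}^n$ be its ground state. Let $0\le k_0\le n-1$ and $1\le k_1\le n$ be integers. (1) If $H$ satisfies the left $\gamma$-RM condition up to $k_0$, then $\{\psi_k\}$ is $\gamma$-log-concave on $\{0,\dots,k_0\}$. (2) If $H$ satisfies the right $\gamma$-RM condition from $k_1$, then $\{\psi_k\}$ is $\gamma$-log-concave on $\{k_1,\dots,n\}$.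
   Context: $H=-A+V$ is the real symmetric $(n+1)\times(n+1)$ matrix indexed by $\{0,\dots,n\}$, where $V$ is the diagonal matrix with entries $V(0),\dots,V(n)$ and $A_{k-1,k}=A_{k,k-1}=a_k$ for $1\le k\le n$, all other entries of $A$ being $0$. Its lowest eigenvalue $E_0$ is simple and the corresponding normalized eigenvector (ground state) $(\psi_k)_{k=0}^n$ is chosen with all entries positive; set $\psi_{-1}=\psi_{n+1}=0$. Put $F(k)=V(k)-E_0$ (one has $F(k)>0$ for all $0\le k\le n$). The sequence $\{\psi_k\}$ is called $\gamma$-log-concave on an interval $I\subseteq\{0,\dots,n\}$ if $\psi_k^2\ge\gamma_k\psi_{k-1}\psi_{k+1}$ for all $k\in I$. Define cumulative weights $$\Gamma_k^-=\frac{a_1}{F(0)}\prod_{\ell=0}^{k-1}\gamma_\ell,\qquad \Gamma_k^+=\frac{a_n}{F(n)}\prod_{\ell=k+1}^{n}\gamma_\ell,$$ where empty products equal $1$. $H$ satisfies the left $\gamma$-RM ($\gamma$-relative monotonicity) condition up to $k_0$ if, for all $1\le k\le k_0$, $$a_k\gamma_kF(k)-a_{k+1}F(k-1)\ \le\ \Gamma_{k-1}^-\left(a_k^2\gamma_k\gamma_{k-1}-a_{k+1}a_{k-1}\right).$$ $H$ satisfies the right $\gamma$-RM condition from $k_1$ if, for all $k_1\le k\le n-1$, $$a_{k+1}\gamma_kF(k)-a_kF(k+1)\ \le\ \Gamma_{k+1}^+\left(a_{k+1}^2\gamma_{k+1}\gamma_k-a_{k+2}a_k\right).$$ *)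

(* Defs.v *)
From HB Require Import structures.
From mathcomp Require Import all_boot all_order all_algebra.
From mathcomp Require Import reals.

Set Implicit Arguments.
Unset Strict Implicit.
Unset Printing Implicit Defensive.

Import Order.TTheory GRing.Theory Num.Theory.

Local Open Scope ring_scope.

(* Sequences on {0, .., n} or {0, .., n + 1} (the weights a, the potential V,
   the factors gamma) are functions on nat; values at indices outside the range
   in question are never used. *)

Definition hopping_mx (R : realType) (n : nat) (a : nat -> R) : 'M[R]_n.+1 :=
  \matrix_(i, j) (if (j : nat) == i.+1 then a j
                  else if (i : nat) == j.+1 then a i
                  else 0).

Definition hamiltonian (R : realType) (n : nat) (a V : nat -> R) :
    'M[R]_n.+1 :=
  - hopping_mx n a + diag_mx (\row_i V i).

(* The library's [eigenvalue] refers to row eigenvectors; over a field these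
   are the same scalars as for column eigenvectors. *)
Definition lowest_eigenvalue (R : realType) (m : nat) (H : 'M[R]_m) (E0 : R) :=
  eigenvalue H E0 /\ (forall E, eigenvalue H E -> E0 <= E).

Definition ground_state (R : realType) (m : nat) (H : 'M[R]_m) (E0 : R)
    (psi : 'cV[R]_m) :=
  [/\ lowest_eigenvalue H E0,
      H *m psi = E0 *: psi,
      \sum_k psi k 0 ^+ 2 = 1
    & forall k, 0 < psi k 0].

(* psi_k for an integer index k, equal to 0 outside {0, .., n}; in particular
   psi_{-1} = psi_{n+1} = 0. *)
Definition entry (R : realType) (n : nat) (psi : 'cV[R]_n.+1) (k : int) : R :=
  match k with
  | Posz m => if insub m is Some i then psi i 0 else 0
  | Negz _ => 0
  end.

Definition log_concave_on (R : realType) (n : nat) (gamma : nat -> R)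
    (psi : 'cV[R]_n.+1) (I : {set 'I_n.+1}) :=
  forall k : 'I_n.+1, k \in I ->
    entry psi k%:Z ^+ 2 >=
      gamma k * entry psi (k%:Z - 1) * entry psi (k%:Z + 1).

Definition excess (R : realType) (V : nat -> R) (E0 : R) (k : nat) : R :=
  V k - E0.

Definition Gamma_left (R : realType) (a gamma F : nat -> R) (k : nat) : R :=
  a 1%N / F 0%N * \prod_(0 <= l < k) gamma l.

Definition Gamma_right (R : realType) (n : nat) (a gamma F : nat -> R)
    (k : nat) : R :=
  a n / F n * \prod_(k.+1 <= l < n.+1) gamma l.

Definition left_RM (R : realType) (a gamma F : nat -> R) (k0 : nat) :=
  forall k : nat, (1 <= k <= k0)%N ->
    a k * gamma k * F k - a k.+1 * F k.-1
      <= Gamma_left a gamma F k.-1 *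
         (a k ^+ 2 * gamma k * gamma k.-1 - a k.+1 * a k.-1).

Definition right_RM (R : realType) (n : nat) (a gamma F : nat -> R)
    (k1 : nat) :=
  forall k : nat, (k1 <= k <= n.-1)%N ->
    a k.+1 * gamma k * F k - a k * F k.+1
      <= Gamma_right n a gamma F k.+1 *
         (a k.+1 ^+ 2 * gamma k.+1 * gamma k - a k.+2 * a k).

(* Main.v *)
(* Row k of H psi = E0 psi is the three-term recurrence
   F(k) psi_k = a_k psi_(k-1) + a_(k+1) psi_(k+1).  Using it at k and at k - 1
   to eliminate psi_(k+1) and a_k psi_k, log-concavity at k - 1 and the RM
   condition reduce log-concavity at k to the ratio bound
   Gamma_k psi_k <= psi_(k-1).  This bound starts as an equality at k = 1 and is
   carried from k to k + 1 by log-concavity at k, so the two are proved by a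
   joint induction.  The right-hand statement is the left-hand one for the chain
   read backwards. *)

Require Import Defs.
From HB Require Import structures.
From mathcomp Require Import all_boot all_order all_algebra.
From mathcomp Require Import reals.
From mathcomp Require Import ring lra zify.
Import Order.TTheory GRing.Theory Num.Theory.
Local Open Scope ring_scope.

(* Sequences on {-1, .., n + 1} are stored with indices shifted by one:
   [q k.+1] stands for psi_k, and [q 0] for psi_(-1). *)
Lemma left_log_concave (R : realType) (n : nat) (a g F q : nat -> R) (k0 : nat)
    (a_gt0 : forall k, (1 <= k <= n)%N -> 0 < a k)
    (g_gt0 : forall k, (1 <= k <= n.-1)%N -> 0 < g k)
    (a_0 : a 0%N = 0) (g_0 : g 0%N = 1)
    (a_g : forall k, (1 <= k <= n)%N ->
       a k ^+ 2 * g k * g k.-1 >= a k.-1 * a k.+1)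
    (q_0 : q 0%N = 0)
    (q_gt0 : forall k, (k <= n)%N -> 0 < q k.+1)
    (q_rec : forall k, (k <= n)%N ->
       F k * q k.+1 = a k * q k + a k.+1 * q k.+2)
    (RM : left_RM a g F k0) (k : nat) (k_le : (k <= k0)%N) (k_lt : (k < n)%N) :
  [/\ 0 <= Gamma_left a g F k.+1,
      Gamma_left a g F k.+1 * q k.+2 <= q k.+1
    & g k * q k * q k.+2 <= q k.+1 ^+ 2].
Proof.
elim: k k_le k_lt => [_ n_gt0|k IH k_lt k1_lt].
  (* Since psi_(-1) = 0 and gamma_0 = 1, row 0 yields both F(0) > 0 and the equality Gamma_1 psi_1 =
     psi_0. *)
  have q1 := q_gt0 0%N isT; have q2 := q_gt0 1%N n_gt0.
  have rec0 : F 0%N * q 1%N = a 1%N * q 2%N by rewrite q_rec// q_0 mulr0 add0r.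
  have F0 : 0 < F 0%N by rewrite -(pmulr_lgt0 _ q1) rec0 mulr_gt0// a_gt0.
  rewrite /Gamma_left big_nat1 g_0 mulr1 q_0 mulr0 mul0r sqr_ge0; split=> //.
    by rewrite divr_ge0 ?ltW ?a_gt0.
  by rewrite mulrAC -rec0 [F 0%N * _]mulrC mulfK ?gt_eqF.
have [Gk1 ratk lck] := IH (ltnW k_lt) (ltnW k1_lt).
have gk : 0 < g k.
  by case: (k) k1_lt => [|j] j_lt; rewrite ?g_0// g_gt0//; lia.
have gk1 : 0 < g k.+1 by rewrite g_gt0//; lia.
have qk1 : 0 < q k.+1 by rewrite q_gt0//; lia.
have qk2 : 0 < q k.+2 by rewrite q_gt0//; lia.
have ak1 : 0 < a k.+1 by rewrite a_gt0//; lia.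
have ak2 : 0 < a k.+2 by rewrite a_gt0//; lia.
(* Not strict: k = 0 is allowed, where a_0 = 0. *)
have ak : 0 <= a k.
  by case: (k) k1_lt => [|j] j_lt; rewrite ?a_0// ltW// a_gt0//; lia.
have GS j : Gamma_left a g F j.+1 = Gamma_left a g F j * g j.
  by rewrite /Gamma_left big_nat_recr//= mulrA.
have rk := q_rec k (ltac:(lia)).
have rk1 := q_rec k.+1 (ltac:(lia)).
have rm := RM k.+1 k_lt.
have D0 := a_g k.+1 (ltac:(lia)).
rewrite /= in rm D0.
have lc : g k.+1 * q k.+1 * q k.+3 <= q k.+2 ^+ 2.
  (* This positive factor supplies the products [a k.+1 * q k.+2] and [a k.+2 * q k.+3], which rows
     k and k + 1 then eliminate. *)
  have m0 : 0 < g k * a k.+1 * a k.+2 by rewrite !mulr_gt0.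
  rewrite -subr_ge0 -(pmulr_rge0 _ m0).
  have -> : g k * a k.+1 * a k.+2 *
              (q k.+2 ^+ 2 - g k.+1 * q k.+1 * q k.+3) =
      g k * a k.+2 * q k.+2 * (a k.+1 * q k.+2) -
      g k * a k.+1 * g k.+1 * q k.+1 * (a k.+2 * q k.+3) by ring.
  have -> : a k.+1 * q k.+2 = F k * q k.+1 - a k * q k by rewrite rk; ring.
  have -> : a k.+2 * q k.+3 = F k.+1 * q k.+2 - a k.+1 * q k.+1.
    by rewrite rk1; ring.
  (* With D the bracket in [rm], [t1] bounds the terms in F by RM and [t2] the term in psi_(k-1) by
     log-concavity at k. What remains is D psi_k (psi_k - Gamma_(k+1) psi_(k+1)), nonnegative by
     [t3]. *)
  have p0 : 0 < g k * q k.+1 * q k.+2 by rewrite !mulr_gt0.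
  have t1 := ler_wpM2l (ltW p0) rm.
  have t2 := ler_wpM2l (mulr_ge0 (ltW ak2) ak) lck.
  have t3 : 0 <= (a k.+1 ^+ 2 * g k.+1 * g k - a k * a k.+2) * q k.+1 *
                 (q k.+1 - Gamma_left a g F k.+1 * q k.+2).
    by rewrite !mulr_ge0 ?subr_ge0// ltW.
  rewrite GS in t3.
  lra.
split=> //; rewrite GS; first by rewrite mulr_ge0// ltW.
(* After scaling by psi_k, the bound passes through Gamma_(k+1) psi_(k+1)^2: [lc] gives one half,
   the previous ratio bound the other. *)
rewrite -(ler_pM2l qk1).
have t1 := ler_wpM2l Gk1 lc.
have t2 := ler_wpM2l (ltW qk2) ratk.
lra.
Qed.

(** The zeros of [q] at both ends stand in for the missing neighbours, so the first and last rows
    obey the same formula as the inner ones. *)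
Lemma hopping_mulmx (R : realType) (n : nat) (a q : nat -> R)
    (psi : 'cV[R]_n.+1) (i : 'I_n.+1)
    (q_0 : q 0%N = 0) (q_psi : forall j : 'I_n.+1, q j.+1 = psi j 0)
    (q_n2 : q n.+2 = 0) :
  (hopping_mx n a *m psi) i 0 = a i * q i + a i.+1 * q i.+2.
Proof.
rewrite mxE.
(* Subdiagonal and superdiagonal parts, each with at most one term. *)
transitivity (\sum_(j < n.+1 | i == j.+1 :> nat) a i * q j.+1 +
              \sum_(j < n.+1 | j == i.+1 :> nat) a j * q j.+1).
  rewrite [X in _ = X + _]big_mkcond [X in _ = _ + X]big_mkcond -big_split /=.
  apply: eq_bigr => j _; rewrite mxE q_psi.
  case: eqP => [->|_].
    by rewrite ifF ?add0r//; lia.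
  by case: eqP; rewrite ?addr0// mul0r.
rewrite (big_ord1_eq _ (fun j => a j * q j.+1)) ltnS; congr (_ + _).
  case: i => [[|i] /= i_le].
    by rewrite big_pred0 ?q_0 ?mulr0// => j; lia.
  under eq_bigl => j do rewrite eqSS eq_sym.
  by rewrite (big_ord1_eq _ (fun j => a i.+1 * q j.+1)) ltnW.
case: ifPn => // i_ge; have -> : i.+2 = n.+2 by have := ltn_ord i; lia.
by rewrite q_n2 mulr0.
Qed.

Theorem theorem3 (R : realType) (n : nat) (a gamma V : nat -> R) (E0 : R)
    (psi : 'cV[R]_n.+1) (k0 k1 : nat)
    (n_ge1 : (1 <= n)%N)
    (a_gt0 : forall k : nat, (1 <= k <= n)%N -> 0 < a k)
    (a_0 : a 0%N = 0)
    (a_n1 : a n.+1 = 0)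
    (gamma_gt0 : forall k : nat, (1 <= k <= n.-1)%N -> 0 < gamma k)
    (gamma_0 : gamma 0%N = 1)
    (gamma_n : gamma n = 1)
    (a_gamma : forall k : nat, (1 <= k <= n)%N ->
       a k ^+ 2 * gamma k * gamma k.-1 >= a k.-1 * a k.+1)
    (psi_gs : ground_state (hamiltonian n a V) E0 psi)
    (k0_le : (k0 <= n.-1)%N)
    (k1_bnd : (1 <= k1 <= n)%N) :
  (left_RM a gamma (excess V E0) k0 ->
     log_concave_on gamma psi [set k : 'I_n.+1 | (k <= k0)%N])
  /\
  (right_RM n a gamma (excess V E0) k1 ->
     log_concave_on gamma psi [set k : 'I_n.+1 | (k1 <= k)%N]).
Proof.
case: psi_gs => _ eig _ psi_gt0.
(* The zero padding of [entry] makes [q n.+2] vanish. *)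
pose q (j : nat) : R := if j is i.+1 then entry psi i%:Z else 0.
have q_psi (j : 'I_n.+1) : q j.+1 = psi j 0 by rewrite /q /= valK.
have q_n2 : q n.+2 = 0 by rewrite /q /= insubN// ltnn.
have q_gt0 k : (k <= n)%N -> 0 < q k.+1.
  by rewrite -ltnS => k_le; rewrite (q_psi (Ordinal k_le)).
have q_rec k : (k <= n)%N ->
    excess V E0 k * q k.+1 = a k * q k + a k.+1 * q k.+2.
  rewrite -ltnS => k_le; pose i := Ordinal k_le.
  have /matrixP/(_ i 0) := eig.
  rewrite mulmxDl mulNmx mul_diag_mx !mxE.
  rewrite (_ : \sum_j _ = (hopping_mx n a *m psi) i 0); last by rewrite mxE.
  rewrite (@hopping_mulmx _ _ _ q)// -q_psi /= /excess => eigi.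
  lra.
have entry_q (k : 'I_n.+1) :
    gamma k * q k * q k.+2 <= q k.+1 ^+ 2 ->
    gamma k * entry psi (k%:Z - 1) * entry psi (k%:Z + 1)
      <= entry psi k%:Z ^+ 2.
  have -> : entry psi (k%:Z - 1) = q k.
    by case: (nat_of_ord k) => [|j]//; rewrite intS addrAC subrr add0r.
  by rewrite -[k%:Z + 1]/(Posz (k + 1)) addn1.
split=> RM k; rewrite inE => k_bnd; apply: entry_q.
  by have [] := @left_log_concave R n a gamma _ q k0 a_gt0 gamma_gt0 a_0
    gamma_0 a_gamma erefl q_gt0 q_rec RM k k_bnd (ltac:(lia)).
have k_le : (k <= n)%N by rewrite -ltnS.
have [k_eq|k_lt] := eqVneq (k : nat) n.
  by rewrite k_eq q_n2 mulr0 sqr_ge0.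
(* Reflection k -> n - k of the sites. The weight a_k sits on the edge between k - 1 and k, hence n
   + 1 - j; the shifted [q] gives n + 2 - j. *)
have [] := @left_log_concave R n (fun j => a (n.+1 - j)%N)
  (fun j => gamma (n - j)%N) (fun j => excess V E0 (n - j)%N)
  (fun j => q (n.+2 - j)%N) (n - k1) _ _ _ _ _ _ _ _ _ (n - k)%N
  (ltac:(lia)) (ltac:(lia)).
- by move=> j j_bnd; rewrite a_gt0//; lia.
- by move=> j j_bnd; rewrite gamma_gt0//; lia.
- by rewrite subn0.
- by rewrite subn0.
- move=> j j_bnd; have := a_gamma (n.+1 - j)%N (ltac:(lia)).
  have -> : (n.+1 - j).-1 = (n - j)%N by lia.
  have -> : (n.+1 - j).+1 = (n.+1 - j.-1)%N by lia.
  have -> : gamma (n.+1 - j)%N = gamma (n - j.-1)%N by congr gamma; lia.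
  by rewrite subSS mulrC -!mulrA [gamma _ * gamma _]mulrC.
- by rewrite subn0.
- by move=> j j_le; rewrite subSS subSn// q_gt0// leq_subr.
- move=> j j_le; have := q_rec (n - j)%N (leq_subr _ _).
  by rewrite !subSS !subSn ?(leqW j_le)// => ->; rewrite addrC.
- move=> j j_bnd; have := RM (n - j)%N (ltac:(lia)).
  (* Reflection turns the product over the first j - 1 sites into one over the last j - 1. *)
  have -> : Gamma_left (fun i => a (n.+1 - i)%N) (fun i => gamma (n - i)%N)
      (fun i => excess V E0 (n - i)%N) j.-1 =
      Gamma_right n a gamma (excess V E0) (n - j).+1.
    rewrite /Gamma_left /Gamma_right subSS !subn0; congr (_ * _).
    rewrite big_nat_rev -[(n - j).+2 in RHS]add0n big_addn.
    rewrite (_ : n.+1 - (n - j).+2 = j.-1)%N; last lia.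
    by apply: eq_big_nat => l l_lt; congr gamma; lia.
  have -> : (n.+1 - j = (n - j).+1)%N by lia.
  have -> : (n.+1 - j.+1 = n - j)%N by lia.
  have -> : (n.+1 - j.-1 = (n - j).+2)%N by lia.
  have -> : (n - j.-1 = (n - j).+1)%N by lia.
  by rewrite [_ ^+ 2 * _ * _]mulrAC [a (n - j).+2 * _]mulrC.
move=> _ _.
rewrite subKn//.
have -> : (n.+2 - (n - k) = k.+2)%N by lia.
have -> : (n.+2 - (n - k).+1 = k.+1)%N by lia.
have -> : (n.+2 - (n - k).+2 = k)%N by lia.
by rewrite mulrAC.
Qed.
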